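(* Let an instance of a multi-objective integer linear programme $\min\{(z_1(x),\dots,z_p(x))=Cx : x\in X\}$ with outcome set $Y=\{Cx:x\in X\}$ be given. Consider the algorithm Bd\_Dichotomy described in the context. Then the algorithm generates only supported nondominated points, and at termination the set $S$ contains the set of all nondominated extreme points of $\operatorname{conv} Y$.
   Context: Setting. $p\ge 2$, $C\in\mathbb{R}^{p\times n}$, $X=\{x\in\mathbb{Z}^n: Ax=b,\ x\geqq 0\}$ with $A\in\mathbb{R}^{m\times n}$, $b\in\mathbb{R}^m$ (all data integer), $z(x)=Cx$, $Y=\{Cx:x\in X\}$. Standing assumptions: no feasible solution minimizes all objectives simultaneously; the ideal point $y^I$, $y^I_k=\min_{x\in X}z_k(x)$, exists and $y^I_k>0$ for all $k$; $\operatorname{conv}Y$ is a polytope. Orders on $\mathbb{R}^p$: $y^1\leqq y^2$ if $y^1_k\le y^2_k$ for all $k$; $y^1\le y^2$ if $y^1\leqq y^2$ and $y^1\ne y^2$. $\mathbb{R}^p_>$ is the set of vectors with all components strictly positive. A point $y\in Y$ is nondominated if there is no $y'\in Y$ with $y'\le y$. It is a supported nondominated point if $y=z(x)$ for an optimal solution $x$ of the weighted sum problem $\min\{\lambda^Tz(x):x\in X\}$ for some $\lambda\in\mathbb{R}^p_>$. The nondominated extreme points are the supported nondominated points that are vertices of $\operatorname{conv}Y$. The same notions apply to problems with fewer objectives. A face $F$ of a $p$-dimensional polytope $P$ is nondominated if for every $y\in F$ there is no $y'\in P$ with $y'\le y$; a facet is nondominated if and only if its normal vectors pointing to the interior of $P$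 have all components strictly positive. For $k\in\{1,\dots,p\}$, the $k$-th associated $(p-1)$-objective subproblem is the problem over the same feasible set $X$ with objectives $(z_1,\dots,z_{k-1},z_{k+1},\dots,z_p)$. Algorithm Bd\_Dichotomy. Initialize $S$ with the nondominated extreme points obtained from the $p$ associated $(p-1)$-objective subproblems, i.e. the set of all nondominated points $y\in Y$ (of the $p$-objective problem) such that, for some $k$, the projection of $y$ obtained by deleting its $k$-th component is a nondominated extreme point of the $k$-th subproblem. The polytope $\operatorname{conv}S$ is assumed to be of dimension $p$, so that its facets and their normals pointing to the interior are well defined. Repeat the following until all nondominated facets of $\operatorname{conv}S$ have been explored: (i) compute/update $\operatorname{conv}S$; (ii) choose any unexplored facet $F$ of $\operatorname{conv}S$ whose normal vector $\lambda$ pointing to the interior satisfies $\lambda\in\mathbb{R}^p_>$; (iii) solve the weighted sum problem $\min\{\lambda^Tz(x):x\in X\}$, let $x$ be the optimal solution found, $y=z(x)$, and let $y'$ be a point of $F$; (iv) if $\lambda^Ty'=\lambda^Ty$, then $F$ is (a part of) a nondominated facet of $\operatorname{conv}Y$ and is marked explored; otherwise $y$ is added to $S$. *)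

(* Defs.v *)
From HB Require Import structures.
From mathcomp Require Import all_boot all_order all_algebra.
From mathcomp Require Import boolp classical_sets cardinality reals convex.

Set Implicit Arguments.
Unset Strict Implicit.
Unset Printing Implicit Defensive.

Import Order.TTheory GRing.Theory Num.Theory.

Local Open Scope classical_set_scope.
Local Open Scope ring_scope.

Section Orders.
Variables (R : realType) (p : nat).
Implicit Types (y lam : 'cV[R]_p) (P F : set 'cV[R]_p).

Definition dot lam y : R := \sum_(k < p) lam k 0 * y k 0.

Definition weakly_dominates y1 y2 : Prop := forall k, y1 k 0 <= y2 k 0.

Definition dominates y1 y2 : Prop := weakly_dominates y1 y2 /\ y1 <> y2.

Definition positive lam : Prop := forall k, 0 < lam k 0.

End Orders.

Section Polytopes.
Variables (R : realType) (p : nat).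
Implicit Types (y lam : 'cV[R]_p) (S P F : set 'cV[R]_p).

Definition convex_hull S : set 'cV[R]_p :=
  smallest (fun P => convex_set (P : set (convex_lmodType 'cV[R]_p))) S.

Definition polytope P : Prop := exists2 V, finite_set V & P = convex_hull V.

Definition affinely_independent (d : nat) (y : 'I_d -> 'cV[R]_p) : Prop :=
  forall a : 'I_d -> R,
    \sum_i a i = 0 -> \sum_i a i *: y i = 0 -> forall i, a i = 0.

(* P has affine dimension d: it contains d + 1 affinely independent points,
   but not d + 2. *)
Definition has_dim P (d : nat) : Prop :=
  (exists y : 'I_d.+1 -> 'cV[R]_p,
     (forall i, P (y i)) /\ affinely_independent y) /\
  (forall y : 'I_d.+2 -> 'cV[R]_p,
     (forall i, P (y i)) -> ~ affinely_independent y).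

(* Taking lam = 0 gives the improper faces P and set0. *)
Definition face P F : Prop :=
  exists (lam : 'cV[R]_p) (c : R),
    (forall y, P y -> c <= dot lam y) /\
    F = [set y | P y /\ dot lam y = c].

Definition vertex P y : Prop := face P [set y].

(* Meant for P of full dimension p. *)
Definition facet P F : Prop := face P F /\ has_dim F p.-1.

(* For a facet F of a p-dimensional P: lam is orthogonal to the affine hull
   of F and points towards the interior of P. *)
Definition inner_normal P F lam : Prop :=
  lam != 0 /\ forall y' y, F y' -> P y -> dot lam y' <= dot lam y.

Definition nondominated_face P F : Prop :=
  face P F /\ forall y, F y -> ~ exists2 y', P y' & dominates y' y.

End Polytopes.

(* min { C x : A x = b, x >= 0, x integer } with integer data A, b, C. *)
Record moilp (m n p : nat) := MOILP {
  constraint_mx : 'M[int]_(m, n);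
  constraint_rhs : 'cV[int]_m;
  objective_mx : 'M[int]_(p, n)
}.

(* The subproblem obtained by deleting the k-th objective. *)
Definition subproblem m n p (I : moilp m n p) (k : 'I_p) : moilp m n p.-1 :=
  MOILP (constraint_mx I) (constraint_rhs I) (row' k (objective_mx I)).

Section Problem.
Variables (R : realType) (m n p : nat) (I : moilp m n p).
Implicit Types (x : 'cV[int]_n) (y lam : 'cV[R]_p).

Definition feasible : set 'cV[int]_n :=
  [set x | constraint_mx I *m x = constraint_rhs I /\ forall j, 0 <= x j 0].

Definition z x : 'cV[R]_p := map_mx intr (objective_mx I *m x).

Definition outcomes : set 'cV[R]_p := z @` feasible.

Definition ideal_point y : Prop :=
  forall k, (exists2 x, feasible x & y k 0 = z x k 0) /\
            (forall x, feasible x -> y k 0 <= z x k 0).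

Definition nondominated y : Prop :=
  outcomes y /\ ~ exists2 y', outcomes y' & dominates y' y.

Definition weighted_sum_optimal lam x : Prop :=
  feasible x /\ forall x', feasible x' -> dot lam (z x) <= dot lam (z x').

Definition supported_nondominated y : Prop :=
  nondominated y /\
  exists lam x, [/\ positive lam, weighted_sum_optimal lam x & y = z x].

Definition nondominated_extreme y : Prop :=
  supported_nondominated y /\ vertex (convex_hull outcomes) y.

Definition standing_assumptions : Prop :=
  [/\ ~ (exists2 x, feasible x & forall k x', feasible x' ->
           z x k 0 <= z x' k 0),
      exists2 yI, ideal_point yI & forall k, 0 < yI k 0
    & polytope (convex_hull outcomes)].

End Problem.

Section BdDichotomy.
Variables (R : realType) (m n p : nat) (I : moilp m n p).

Definition bd_init : set 'cV[R]_p :=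
  [set y | nondominated I y /\
           exists k, nondominated_extreme (subproblem I k) (row' k y)].

Record bd_state := BdState {
  points : set 'cV[R]_p;
  explored : set (set 'cV[R]_p)
}.

(* bd_step s y s': one iteration takes s to s', and y is the outcome returned
   by its weighted sum problem.  Any unexplored facet and any optimal solution
   may be chosen. *)
Inductive bd_step : bd_state -> 'cV[R]_p -> bd_state -> Prop :=
| bd_step_explore S E F lam x y' :
    facet (convex_hull S) F -> ~ E F -> inner_normal (convex_hull S) F lam ->
    positive lam -> weighted_sum_optimal I lam x -> F y' ->
    dot lam y' = dot lam (z R I x) ->
    bd_step (BdState S E) (z R I x) (BdState S (E `|` [set F]))
| bd_step_add S E F lam x y' :
    facet (convex_hull S) F -> ~ E F -> inner_normal (convex_hull S) F lam ->
    positive lam -> weighted_sum_optimal I lam x -> F y' ->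
    dot lam y' <> dot lam (z R I x) ->
    bd_step (BdState S E) (z R I x) (BdState (S `|` [set z R I x]) E).

Inductive bd_reachable : bd_state -> Prop :=
| bd_reachable_init : bd_reachable (BdState bd_init set0)
| bd_reachable_step s y s' :
    bd_reachable s -> bd_step s y s' -> bd_reachable s'.

Definition bd_terminated (s : bd_state) : Prop :=
  forall F, facet (convex_hull (points s)) F ->
    nondominated_face (convex_hull (points s)) F -> explored s F.

(* All points the algorithm produces: the elements of S and every outcome of
   a weighted sum problem, including those that are not added to S. *)
Definition bd_generated (y : 'cV[R]_p) : Prop :=
  exists2 s, bd_reachable s & points s y \/ exists s', bd_step s y s'.

End BdDichotomy.

(* Main.v *)
(* Write f_T(lam) for the minimum of the weighted sum lam over a finite set T of
   outcomes, with lam ranging over the nonnegative orthant.  The initial points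
   solve the subproblems, so f_S = f_Y on the boundary of the orthant.  If an
   extreme point y is missing from S, then lam.(s - y) > 0 for all s in S and
   some positive lam, whereas this fails on the boundary; so the polyhedron of
   weights with lam.(s - y) >= 1 for all s in S has a vertex in the open orthant,
   which is the positive normal of a facet of conv S visible from y.  At
   termination that facet has been explored, hence cannot be visible from y. *)

Require Import Defs.
From mathcomp Require Import all_boot all_order all_algebra.
From mathcomp Require Import boolp classical_sets cardinality reals convex.
From mathcomp Require Import interval_inference ring lra.

Set Implicit Arguments.
Unset Strict Implicit.
Unset Printing Implicit Defensive.

Import Order.TTheory GRing.Theory Num.Theory.

Local Open Scope classical_set_scope.
Local Open Scope ring_scope.

(** * Finite minima and small perturbations *)

Section Finite.
Variable R : realType.

Lemma seq_argmin (T : eqType) (s : seq T) (f : T -> R) x :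
  x \in s -> exists2 y, y \in s & {in s, forall y', f y <= f y'}.
Proof.
elim: s x => [//|a [|b s] IH] x _.
  by exists a; rewrite ?mem_head// => y; rewrite inE => /eqP ->.
have [y ys ymin] := IH b (mem_head _ _).
have [fay|fya] := leP (f a) (f y).
  exists a; first exact: mem_head.
  move=> y'; rewrite inE => /orP[/eqP -> //|/ymin]; exact: le_trans.
exists y; first by rewrite inE ys orbT.
by move=> y'; rewrite inE => /orP[/eqP ->|/ymin //]; exact: ltW.
Qed.

(** Finitely many strict inequalities survive a small perturbation; used below to tilt and to
    rescale weights. *)
Lemma pos_perturb (T : eqType) (s : seq T) (a b : T -> R) :
  {in s, forall i, 0 < a i} ->
  exists2 e0, 0 < e0 &
    forall e, 0 < e <= e0 -> {in s, forall i, 0 < a i + e * b i}.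
Proof.
elim: s => [_|i s IH pos]; first by exists 1.
have [|e1 e1_gt0 He1] := IH; first by move=> j js; rewrite pos// inE js orbT.
have ai_gt0 : 0 < a i by rewrite pos// mem_head.
have d_gt0 : 0 < `|b i| + 1 by rewrite ltr_wpDl.
(* The [+ 1] keeps the denominator nonzero and leaves the perturbed value at least [e]. *)
exists (Num.min e1 (a i / (`|b i| + 1))).
  by rewrite lt_min e1_gt0 divr_gt0.
move=> e /andP[e_gt0]; rewrite le_min => /andP[ee1].
rewrite ler_pdivlMr// => ea j; rewrite inE => /orP[/eqP ->|]; last first.
  by apply: He1; rewrite e_gt0.
have : e * - b i <= e * `|b i| by rewrite ler_pM2l// lerNl lerNnormlW.
lra.
Qed.

End Finite.

(** * Bilinearity and monotonicity of the weighted sum *)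

Section Dot.
Variables (R : realType) (p : nat).
Implicit Types (lam y : 'cV[R]_p).

Lemma dotE lam y : dot lam y = (lam^T *m y) 0 0.
Proof. by rewrite mxE; apply: eq_bigr => k _; rewrite mxE. Qed.

Lemma dotDr lam y1 y2 : dot lam (y1 + y2) = dot lam y1 + dot lam y2.
Proof. by rewrite !dotE mulmxDr mxE. Qed.

Lemma dotBr lam y1 y2 : dot lam (y1 - y2) = dot lam y1 - dot lam y2.
Proof. by rewrite !dotE mulmxBr !mxE. Qed.

Lemma dotZr lam a y : dot lam (a *: y) = a * dot lam y.
Proof. by rewrite !dotE -scalemxAr mxE. Qed.

Lemma dotC lam y : dot lam y = dot y lam.
Proof. by apply: eq_bigr => k _; rewrite mulrC. Qed.

Lemma dotDl lam1 lam2 y : dot (lam1 + lam2) y = dot lam1 y + dot lam2 y.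
Proof. by rewrite dotC dotDr !(dotC y). Qed.

Lemma dotBl lam1 lam2 y : dot (lam1 - lam2) y = dot lam1 y - dot lam2 y.
Proof. by rewrite dotC dotBr !(dotC y). Qed.

Lemma dotZl a lam y : dot (a *: lam) y = a * dot lam y.
Proof. by rewrite dotC dotZr dotC. Qed.

Lemma dot_gt0 y : y != 0 -> 0 < dot y y.
Proof.
have sq_ge0 k : 0 <= y k 0 * y k 0 by rewrite -expr2 sqr_ge0.
move=> y0; rewrite lt_neqAle sumr_ge0// andbT eq_sym.
apply: contraNneq y0 => /psumr_eq0P y0; apply/eqP/colP => k.
by move/eqP: (y0 (fun i _ => sq_ge0 i) k isT); rewrite mulf_eq0 orbb mxE => /eqP.
Qed.

Lemma dot_le lam y1 y2 :
  (forall k, 0 <= lam k 0) -> weakly_dominates y1 y2 ->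
  dot lam y1 <= dot lam y2.
Proof. by move=> lam_ge0 y12; apply: ler_sum => k _; rewrite ler_wpM2l. Qed.

Lemma dot_lt lam y1 y2 : positive lam -> dominates y1 y2 -> dot lam y1 < dot lam y2.
Proof.
move=> lam_gt0 [y12 neq]; rewrite lt_neqAle dot_le ?andbT//; last first.
  by move=> k; exact: ltW.
apply/eqP => eq; apply: neq; apply/colP => k; apply/eqP.
have /psumr_eq0P : \sum_k lam k 0 * (y2 k 0 - y1 k 0) = 0.
  transitivity (dot lam (y2 - y1)); first by apply: eq_bigr => j _; rewrite !mxE.
  by rewrite dotBr eq subrr.
move=> /(_ _ k isT) H; have {H} : lam k 0 * (y2 k 0 - y1 k 0) = 0.
  by apply: H => j _; rewrite mulr_ge0 ?subr_ge0// ltW.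
by move/eqP; rewrite mulf_eq0 gt_eqF//= subr_eq0 eq_sym.
Qed.

Lemma dot_row' (k : 'I_p) lam y :
  dot lam y = lam k 0 * y k 0 + dot (row' k lam) (row' k y).
Proof.
by rewrite /dot (bigD1_ord k)//; congr (_ + _); apply: eq_bigr => j _; rewrite !mxE.
Qed.

End Dot.

(** * Vertices of convex hulls as unique minimizers *)

Section Hull.
Variables (R : realType) (p : nat).
Implicit Types (lam y q : 'cV[R]_p) (Z : set 'cV[R]_p).

Lemma sub_hull Z : Z `<=` convex_hull Z.
Proof. exact: sub_gen_smallest. Qed.

Lemma hull_min Z (P : set 'cV[R]_p) :
  (forall y1 y2 (t : R), 0 <= t <= 1 -> P y1 -> P y2 -> P (t *: y1 + (1 - t) *: y2)) ->
  Z `<=` P -> convex_hull Z `<=` P.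
Proof.
move=> cvxP; apply: smallest_sub => y1 y2 t.
rewrite !inE => Py1 Py2; apply: cvxP => //.
by rewrite ge0 le1.
Qed.

Lemma hull_dot_ge Z lam c :
  (forall y, Z y -> c <= dot lam y) -> forall y, convex_hull Z y -> c <= dot lam y.
Proof.
move=> Zc; apply: hull_min => // y1 y2 t /andP[t0 t1] c1 c2.
rewrite dotDr !dotZr.
have : 0 <= t * (dot lam y1 - c) by rewrite mulr_ge0// subr_ge0.
have : 0 <= (1 - t) * (dot lam y2 - c) by rewrite mulr_ge0// subr_ge0.
lra.
Qed.

Lemma vertex_strict_min Z q : vertex (convex_hull Z) q ->
  exists lam, forall y, Z y -> y <> q -> dot lam q < dot lam y.
Proof.
case=> lam [c [lamc qE]]; exists lam => y Zy yq.
have [_ ->] : [set y | convex_hull Z y /\ dot lam y = c] q by rewrite -qE.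
rewrite lt_neqAle lamc ?andbT; last exact: sub_hull.
apply/eqP => cy; apply: yq; suff : [set q] y by [].
by rewrite qE; split => //; exact: sub_hull.
Qed.

Lemma strict_min_vertex Z q lam :
  Z q -> (forall y, Z y -> y <> q -> dot lam q < dot lam y) ->
  vertex (convex_hull Z) q.
Proof.
move=> Zq qmin; exists lam, (dot lam q).
have lamq : forall y, convex_hull Z y -> dot lam q <= dot lam y.
  apply: hull_dot_ge => y Zy; have [->//|/eqP yq] := eqVneq y q.
  exact/ltW/qmin.
split=> //; rewrite eqEsubset; split=> y /=.
  by move=> ->; split => //; exact: sub_hull.
case=> Hy eqy.
(* This set is convex and contains [Z], so on the hull the minimum of [lam] is attained at [q]
   only. *)
have : [set y | dot lam q < dot lam y \/ y = q] y.
  move: Hy; apply: hull_min => [y1 y2 t /andP[t0 t1] P1 P2 /=|y' Zy' /=].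
    2: by have [->|/eqP yq] := eqVneq y' q; [right|left; exact: qmin].
  have [->|tn0] := eqVneq t 0; first by rewrite scale0r add0r subr0 scale1r.
  have [->|tn1] := eqVneq t 1; first by rewrite subrr scale0r addr0 scale1r.
  have t_gt0 : 0 < t by rewrite lt0r tn0.
  have t_lt1 : 0 < 1 - t by rewrite subr_gt0 lt_neqAle tn1.
  rewrite dotDr !dotZr.
  case: P1 => [l1|->]; case: P2 => [l2|->].
  - left.
    have : 0 < t * (dot lam y1 - dot lam q) by rewrite mulr_gt0// subr_gt0.
    have : 0 < (1 - t) * (dot lam y2 - dot lam q) by rewrite mulr_gt0// subr_gt0.
    lra.
  - left.
    have : 0 < t * (dot lam y1 - dot lam q) by rewrite mulr_gt0// subr_gt0.
    lra.
  - left.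
    have : 0 < (1 - t) * (dot lam y2 - dot lam q) by rewrite mulr_gt0// subr_gt0.
    lra.
  - by right; rewrite -scalerDl addrC subrK scale1r.
by case=> // ; rewrite eqy ltxx.
Qed.

End Hull.

(** * Supported and extreme outcomes *)

Section Outcomes.
Variables (R : realType) (m n p : nat) (I : moilp m n p).
Implicit Types (lam y : 'cV[R]_p) (Ys : seq 'cV[R]_p).

(** For a positive weight a dominating outcome has a strictly smaller weighted sum, so optimality
    entails nondominance. *)
Lemma supportedP y : supported_nondominated I y <->
  outcomes I y /\
  exists lam, positive lam /\ forall y', outcomes I y' -> dot lam y <= dot lam y'.
Proof.
split=> [[_ [lam [x [pos [Fx opt] ->]]]]|[[x Fx <-] [lam [pos opt]]]].
  split; first by exists x.
  by exists lam; split=> // y' [x' Fx' <-]; exact: opt.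
split; last first.
  by exists lam, x; split=> //; split=> // x' Fx'; apply: opt; exists x'.
split; first by exists x.
by case=> y' Yy' /(dot_lt pos); rewrite ltNge opt.
Qed.

(* The supporting weight is tilted slightly towards the functional exposing y. *)
Lemma extreme_strict_support y : nondominated_extreme I y ->
  exists lam, positive lam /\
    forall y', outcomes I y' -> y' <> y -> dot lam y < dot lam y'.
Proof.
case=> /supportedP [Yy [lam [pos opt]]] /vertex_strict_min[mu strict].
have [|e e_gt0 He] := @pos_perturb R _ (enum 'I_p) (fun k => lam k 0) (fun k => mu k 0).
  by move=> k _; exact: pos.
exists (lam + e *: mu); split=> [k|y' Yy' neq].
  by rewrite !mxE He ?mem_enum// e_gt0 lexx.
rewrite !dotDl !dotZl ler_ltD ?opt// ltr_pM2l//; exact: strict.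
Qed.

Definition enumerates (Ys : seq 'cV[R]_p) := forall y, outcomes I y <-> y \in Ys.

(* Among the minimizers of lam, one farthest from the origin is a vertex. *)
Lemma weighted_sum_extreme Ys lam : enumerates Ys -> positive lam ->
  outcomes (R := R) I !=set0 ->
  exists2 q, nondominated_extreme I q &
    forall y, outcomes I y -> dot lam q <= dot lam y.
Proof.
move=> YsE pos [y0 /YsE Ysy0].
have [y1 Ysy1 y1min] := seq_argmin (fun y => dot lam y) Ysy0.
pose M := [seq y <- Ys | dot lam y == dot lam y1].
have My1 : y1 \in M by rewrite mem_filter eqxx.
have [q Mq qmax] := seq_argmin (fun y => - dot y y) My1.
have /andP[/eqP qy1 Ysq] : (dot lam q == dot lam y1) && (q \in Ys).
  by move: Mq; rewrite mem_filter.
have qmin y : outcomes I y -> dot lam q <= dot lam y.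
  by rewrite qy1 => /YsE; exact: y1min.
exists q => //; split.
  by apply/supportedP; split; [exact/YsE|exists lam].
pose U := [seq y <- Ys | dot lam y != dot lam q].
have [|e e_gt0 He] := @pos_perturb R _ U (fun y => dot lam (y - q)) (fun y => - dot q (y - q)).
  move=> y; rewrite mem_filter => /andP[neq /YsE Yy].
  by rewrite dotBr subr_gt0 lt_neqAle eq_sym neq qmin.
(* Among the minimizers of [lam] the tilt decides: |y| <= |q| and |y - q|^2 > 0 give q.y < q.q. For
   the remaining outcomes the choice of [e] preserves the strict inequality. *)
apply: (@strict_min_vertex _ _ _ _ (lam - e *: q)); first exact/YsE.
move=> y Yy yq; rewrite !dotBl !dotZl.
have [eqy|neqy] := eqVneq (dot lam y) (dot lam q); last first.
  have /He : y \in U by rewrite mem_filter neqy; exact/YsE.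
  by move=> /(_ e); rewrite e_gt0 lexx !dotBr => /(_ isT); lra.
rewrite eqy ltrD2l ltrN2 ltr_pM2l//.
have /qmax : y \in M by rewrite mem_filter eqy qy1 eqxx; exact/YsE.
rewrite lerN2.
have : 0 < dot (y - q) (y - q) by apply: dot_gt0; rewrite subr_eq0; exact/eqP.
rewrite dotBr !dotBl (dotC y q); lra.
Qed.

End Outcomes.

(** * Relation between the problem and its subproblems *)

Section Subproblem.
Variables (R : realType) (m n p : nat) (I : moilp m n p).
Implicit Types (lam y : 'cV[R]_p) (Ys : seq 'cV[R]_p).

Lemma z_subproblem k x : z R (subproblem I k) x = row' k (z R I x).
Proof.
apply/colP => j; rewrite !mxE; congr (_%:~R).
by apply: eq_bigr => i _; rewrite !mxE.
Qed.

Lemma outcomes_subproblem k (q : 'cV[R]_(p.-1)) :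
  outcomes (subproblem I k) q <-> exists2 y : 'cV[R]_p, outcomes I y & row' k y = q.
Proof.
split=> [[x Fx <-]|[y [x Fx <-] <-]].
  by exists (z R I x); [exists x|rewrite z_subproblem].
by exists x => //; rewrite z_subproblem.
Qed.

(** Among the outcomes projecting to [q], take one with the least [k]-th coordinate. A dominating
    outcome would either project to one dominating [q], or share the projection and have a smaller
    [k]-th coordinate. *)
Lemma lift_nondominated Ys k (q : 'cV[R]_(p.-1)) : enumerates I Ys ->
  nondominated (subproblem I k) q -> exists2 y, nondominated I y & row' k y = q.
Proof.
move=> YsE [/outcomes_subproblem[y0 Yy0 y0q] qnd].
have : y0 \in [seq y <- Ys | row' k y == q].
  by rewrite mem_filter y0q eqxx; exact/YsE.
move=> /(seq_argmin (fun y : 'cV[R]_p => y k 0))[y].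
rewrite mem_filter => /andP[/eqP yq /YsE Yy] ymin.
exists y => //; split=> // -[y' Yy' [y'y neq]].
have le' : weakly_dominates (row' k y') (row' k y) by move=> j; rewrite !mxE.
have [eq'|neq'] := eqVneq (row' k y') (row' k y); last first.
  apply: qnd; exists (row' k y').
    by apply/outcomes_subproblem; exists y'.
  by rewrite -yq; split => //; exact/eqP.
apply: neq; apply/colP => j; have [j' ->|->] := unliftP k j.
  by move/colP: eq' => /(_ j'); rewrite !mxE.
apply/eqP; rewrite eq_le y'y ymin// mem_filter eq' yq eqxx/=; exact/YsE.
Qed.

Definition join_row' k a (mu : 'cV[R]_(p.-1)) : 'cV[R]_p :=
  \col_j (if unlift k j is Some j' then mu j' 0 else a).

Lemma join_row'K k a mu : row' k (join_row' k a mu) = mu.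
Proof. by apply/colP => j; rewrite !mxE liftK. Qed.

Lemma join_row'_k k a mu : join_row' k a mu k 0 = a.
Proof. by rewrite mxE unlift_none. Qed.

(** The positive weight exposing the projection of [y] is extended by a small weight [e] on
    objective [k]. Outcomes with another projection stay worse for small [e]; those with the same
    projection have no smaller [k]-th coordinate, since [y] is nondominated. *)
Lemma bd_init_supported Ys y : enumerates I Ys ->
  bd_init I y -> supported_nondominated I y.
Proof.
move=> YsE [[Yy ynd] [k /extreme_strict_support[mu [pos strict]]]].
apply/supportedP; split=> //.
pose U := [seq y' <- Ys | row' k y' != row' k y].
have [|e e_gt0 He] := @pos_perturb R _ U
    (fun y' => dot mu (row' k y') - dot mu (row' k y)) (fun y' => y' k 0 - y k 0).
  move=> y'; rewrite mem_filter => /andP[/eqP neq /YsE Yy'].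
  by rewrite subr_gt0; apply: strict => //; apply/outcomes_subproblem; exists y'.
exists (join_row' k e mu); split=> [j|y' Yy'].
  by rewrite mxE; case: unlift.
rewrite !(dot_row' k) !join_row'K join_row'_k.
have [eq'|neq'] := eqVneq (row' k y') (row' k y); last first.
  have /He : y' \in U by rewrite mem_filter neq'; exact/YsE.
  move=> /(_ e); rewrite e_gt0 lexx => /(_ isT); lra.
rewrite eq' lerD2r ler_pM2l// leNgt; apply/negP => lt_k; apply: ynd; exists y' => //.
split=> [j|yy']; last by rewrite yy' ltxx in lt_k.
have [j' ->|->] := unliftP k j; last exact: ltW.
by move/colP: eq' => /(_ j'); rewrite !mxE => ->.
Qed.


Lemma enumerates_subproblem Ys k : enumerates I Ys ->
  enumerates (subproblem I k) [seq row' k y | y : 'cV[R]_p <- Ys].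
Proof.
move=> YsE q; split=> [/outcomes_subproblem[y /YsE Yy <-]|/mapP[y /YsE Yy ->]].
  exact: map_f.
by apply/outcomes_subproblem; exists y.
Qed.

(* Minimizing lam over all outcomes is a limit of subproblems with positive
   weights, and these are solved by initial points. *)
Lemma bd_init_boundary Ys lam k y e : enumerates I Ys ->
  (forall y' : 'cV[R]_p, outcomes I y' -> positive y') ->
  (forall j, 0 <= lam j 0) -> lam k 0 = 0 -> outcomes I y -> 0 < e ->
  exists2 s, bd_init I s & dot lam s < dot lam y + e.
Proof.
move=> YsE Ypos lam_ge0 lamk Yy e_gt0.
pose c := dot (const_mx 1) (row' k y).
have sum_ge0 (y' : 'cV[R]_p) : outcomes I y' -> 0 <= dot (const_mx 1) (row' k y').
  by move=> Yy'; apply: sumr_ge0 => j _; rewrite !mxE mul1r ltW// Ypos.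
have c1_gt0 : 0 < c + 1 by rewrite ltr_wpDl// sum_ge0.
(* Raising each remaining weight by [d] adds only [d * c < e] to the value of [y], and nothing
   negative to any outcome. *)
pose d := e / (c + 1).
have d_gt0 : 0 < d by rewrite divr_gt0.
pose mu : 'cV[R]_(p.-1) := row' k lam + d *: const_mx 1.
have mu_gt0 : positive mu by move=> j; rewrite !mxE mulr1 ltr_wpDl.
have [|q qext qmin] := weighted_sum_extreme (enumerates_subproblem k YsE) mu_gt0.
  by exists (row' k y); apply/outcomes_subproblem; exists y.
have [s snd sq] := lift_nondominated YsE qext.1.1.
exists s; first by split=> //; exists k; rewrite sq.
have /qmin : outcomes (subproblem I k) (row' k y) by apply/outcomes_subproblem; exists y.
rewrite -sq !(dot_row' k lam) lamk !mul0r !add0r !dotDl !dotZl -/c.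
have /(mulr_ge0 (ltW d_gt0)) := sum_ge0 _ snd.1.
have : d * c + d = e by rewrite /d; field; rewrite gt_eqF.
lra.
Qed.

End Subproblem.

(** * Finiteness of the outcome set *)

Section Finiteness.
Variables (R : realType) (m n p : nat) (I : moilp m n p).

(** Outcomes are positive integer vectors whose coordinates are bounded by some [N], because
    finitely many points span the hull; hence each is coded by a function from ['I_p] to ['I_N]. *)
Lemma outcomes_enumerable : (forall y : 'cV[R]_p, outcomes I y -> positive y) ->
  polytope (convex_hull (outcomes (R := R) I)) -> exists Ys : seq 'cV[R]_p, enumerates I Ys.
Proof.
move=> Ypos [V /finite_seqP[s ->] hullE].
have [N HN] : exists N : nat, forall y, y \in s -> forall k, y k 0 < N%:R.
  elim: s {hullE} => [|a s [N HN]]; first by exists 0%N.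
  exists (\sum_k Num.bound `|a k 0%R|%R + N)%N => y; rewrite inE => /orP[/eqP ->|/HN ys] k.
    apply: le_lt_trans (ler_norm _) _; apply: lt_le_trans (archi_boundP (normr_ge0 _)) _.
    by rewrite ler_nat (bigD1 k)//= -addnA leq_addr.
  by apply: lt_le_trans (ys k) _; rewrite ler_nat leq_addl.
have Y_lt (y : 'cV[R]_p) : outcomes I y -> forall k, y k 0 < N%:R.
  move=> /sub_hull; rewrite hullE; move: y.
  apply: (@hull_min _ _ _ [set y | forall k, y k 0 < N%:R]) => // y1 y2 t /andP[t0 t1] l1 l2 k.
  have [->|t_neq0] := eqVneq t 0; first by rewrite scale0r add0r subr0 scale1r.
  have := l1 k; have := l2 k; rewrite -subr_gt0 => h2; rewrite -subr_gt0 => h1.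
  have : 0 < t * (N%:R - y1 k 0) by rewrite mulr_gt0// lt0r t_neq0.
  have : 0 <= (1 - t) * (N%:R - y2 k 0) by rewrite mulr_ge0 ?subr_ge0// ltW.
  rewrite !mxE; lra.
pose g (f : {ffun 'I_p -> 'I_N}) : 'cV[R]_p := \col_k (f k : nat)%:R.
exists [seq y <- [seq g f | f : {ffun 'I_p -> 'I_N}] | `[< outcomes I y >]] => y.
rewrite mem_filter; split=> [Yy|/andP[/asboolP //]].
apply/andP; split; first exact/asboolP.
have [x _ xy] := Yy.
pose w k := `|(objective_mx I *m x) k 0%R|%N.
have wE k : y k 0 = (w k)%:R.
  have := Ypos _ Yy k; rewrite -xy mxE ltr0z => /ltW /gez0_abs {1}<-.
  by rewrite pmulrn.
have w_lt k : (w k < N)%N by rewrite -(ltr_nat R) -wE; exact: Y_lt.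
have -> : y = g [ffun k => Ordinal (w_lt k)].
  by apply/colP => k; rewrite wE mxE ffunE.
by rewrite map_f ?mem_enum.
Qed.

End Finiteness.

(** * A vertex with positive coordinates in the polyhedron of weights *)

Section DualVertex.
Variables (R : realType) (N p : nat) (v : 'I_N -> 'cV[R]_p).
Implicit Types lam d : 'cV[R]_p.

Hypothesis boundary : forall lam k,
  (forall j, 0 <= lam j 0) -> lam k 0 = 0 -> exists i, dot lam (v i) < 1.

Let tight lam i := dot lam (v i) == 1.

(** Rows of slack constraints are zeroed rather than removed, so that matrices for different [lam]
    have one size and their row spaces can be compared. *)
Let tight_mx lam : 'M[R]_(N, p) := \matrix_(i, j) (v i j 0 *+ tight lam i).

Let feasible_dual lam := positive lam /\ forall i, 1 <= dot lam (v i).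

Let tight_mxE lam d i : (tight_mx lam *m d) i 0 = dot d (v i) *+ tight lam i.
Proof.
rewrite mxE -sumrMnl; apply: eq_bigr => j _; rewrite mxE.
by case: (tight lam i); rewrite ?mulr0n ?mul0r// !mulr1n mulrC.
Qed.

Let tight_mx_eq0 lam d :
  (forall i, tight lam i -> dot d (v i) = 0) <-> tight_mx lam *m d = 0.
Proof.
split=> [dv|/colP dv i ti].
  by apply/colP => i; rewrite tight_mxE mxE; case: (boolP (tight lam i)) => [/dv ->|//]; rewrite mul0rn.
by have := dv i; rewrite tight_mxE ti mxE.
Qed.

(** Moving along a kernel direction [d] keeps the tight constraints tight. By [boundary] some
    constraint fails when the ray reaches the boundary of the orthant, so a new one becomes tight
    strictly earlier. *)
Let dual_step lam : feasible_dual lam -> (\rank (tight_mx lam) < p)%N ->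
  exists2 lam', feasible_dual lam' & (\rank (tight_mx lam) < \rank (tight_mx lam'))%N.
Proof.
move=> [lam_gt0 lam_ge1] rk_lt.
have [d d_neq0 dker] : exists2 d : 'cV[R]_p, d != 0 & tight_mx lam *m d = 0.
  have : kermx (tight_mx lam)^T != 0.
    by rewrite kermx_eq0 /row_free mxrank_tr neq_ltn rk_lt.
  move=> /rowV0Pn[w /sub_kermxP wK w0]; exists w^T; first by rewrite trmx_eq0.
  by apply: trmx_inj; rewrite trmx_mul trmxK wK trmx0.
(* Up to replacing [d] by [- d], the ray leaves the orthant. *)
wlog [k dk] : d d_neq0 dker / exists k, d k 0 < 0.
  move=> wlog_neg; have [k dk] : exists k, d k 0 != 0.
    apply/existsP; apply: contraNT d_neq0; rewrite negb_exists => /forallP d0.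
    by apply/eqP/colP => k; rewrite mxE; apply/eqP; rewrite -[_ == _]negbK.
  case: (ltgtP (d k 0) 0) dk => // dk _; first by apply: (wlog_neg d) => //; exists k.
  by apply: (wlog_neg (- d)); rewrite ?oppr_eq0 ?mulmxN ?dker ?oppr0//; exists k; rewrite mxE oppr_lt0.
have sk : k \in [seq k <- enum 'I_p | d k 0 < 0] by rewrite mem_filter dk mem_enum.
have [k1] := seq_argmin (fun k => lam k 0 / - d k 0) sk.
rewrite mem_filter => /andP[dk1 _] k1min.
(* Step length at which the first coordinate of the weight vanishes. *)
pose b := lam k1 0 / - d k1 0.
have b_gt0 : 0 < b by rewrite divr_gt0// oppr_gt0.
have bmax a j : 0 <= a <= b -> 0 <= lam j 0 + a * d j 0.
  move=> /andP[a_ge0 ab]; have [dj|dj] := ltP (d j 0) 0; last first.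
    by rewrite addr_ge0 ?mulr_ge0// ltW.
  have /k1min : j \in [seq k <- enum 'I_p | d k 0 < 0].
    by rewrite mem_filter dj mem_enum.
  move=> /(le_trans ab); rewrite ler_pdivlMr ?oppr_gt0//; lra.
have [i0 i0_lt] : exists i, dot (lam + b *: d) (v i) < 1.
  apply: (boundary (k := k1)) => [j|]; rewrite !mxE.
    by apply: bmax; rewrite lexx ltW.
  by rewrite /b; field; rewrite lt_eqF.
rewrite dotDl dotZl in i0_lt.
have di0 : dot d (v i0) < 0.
  rewrite -(pmulr_rlt0 _ b_gt0); have := lam_ge1 i0; lra.
have si0 : i0 \in [seq i <- enum 'I_N | dot d (v i) < 0].
  by rewrite mem_filter di0 mem_enum.
have [i1] := seq_argmin (fun i => (dot lam (v i) - 1) / - dot d (v i)) si0.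
rewrite mem_filter => /andP[di1 _] i1min.
(* Step length at which the first decreasing constraint becomes tight. *)
pose a := (dot lam (v i1) - 1) / - dot d (v i1).
have a_ge0 : 0 <= a by rewrite divr_ge0 ?subr_ge0// oppr_ge0 ltW.
have ab : a < b.
  apply: le_lt_trans (i1min _ si0) _; rewrite ltr_pdivrMr ?oppr_gt0//; lra.
pose lam' := lam + a *: d.
have lam'E y : dot lam' y = dot lam y + a * dot d y by rewrite dotDl dotZl.
have ti1 : tight lam' i1.
  by rewrite /tight lam'E /a; apply/eqP; field; rewrite lt_eqF.
have tight_sub i : tight lam i -> tight lam' i.
  move=> ti; rewrite /tight lam'E.
  by have /tight_mx_eq0/(_ i ti) -> := dker; rewrite mulr0 addr0.
exists lam'.
  split=> [j|i].
    rewrite !mxE; have [dj|dj] := ltP (d j 0) 0; last first.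
      by rewrite ltr_wpDr// mulr_ge0.
    have := bmax b j; rewrite lexx ltW// => /(_ isT).
    have : 0 < (b - a) * - d j 0 by rewrite mulr_gt0 ?subr_gt0// oppr_gt0.
    lra.
  rewrite lam'E; have [di|di] := ltP (dot d (v i)) 0; last first.
    by rewrite ler_wpDr// mulr_ge0.
  have /i1min : i \in [seq i <- enum 'I_N | dot d (v i) < 0].
    by rewrite mem_filter di mem_enum.
  rewrite -/a ler_pdivlMr ?oppr_gt0//; lra.
(* The old matrix is a diagonal selection of rows of the new one; [d] kills the old rows but not the
   new row [i1], so the inclusion of row spaces is strict. *)
apply: rank_ltmx; rewrite /ltmx; apply/andP; split.
  have -> : tight_mx lam = \matrix_(i, j) ((tight lam i)%:R *+ (i == j)) *m tight_mx lam'.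
    apply/matrixP => i j; rewrite !mxE (bigD1 i)//= big1 ?addr0 => [|l /negPf li].
      rewrite !mxE eqxx; case: (boolP (tight lam i)) => [/tight_sub ->|_].
        by rewrite !mulr1n mul1r.
      by rewrite !mulr0n mul0r.
    by rewrite !mxE eq_sym li mulr0n mul0r.
  exact: submxMl.
apply/negP => /submxP[D lam'D].
have /tight_mx_eq0/(_ _ ti1) : tight_mx lam' *m d = 0.
  by rewrite lam'D -mulmxA dker mulmx0.
by move=> d0; rewrite d0 ltxx in di1.
Qed.

(* A feasible point of [lam >= 0, lam.(v i) >= 1] with a maximal rank of tight
   constraints is a vertex; it cannot leave the open orthant, since the
   constraints are violated on its boundary. *)
Lemma dual_vertex lam0 : positive lam0 -> (forall i, 0 < dot lam0 (v i)) ->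
  exists lam (f : 'I_p -> 'I_N),
    [/\ positive lam, forall i, 1 <= dot lam (v i),
        forall i, dot lam (v (f i)) = 1
      & row_free (\matrix_(i, j) v (f i) j 0)].
Proof.
move=> lam0_gt0 lam0v.
have [lam1 lam1_feas] : exists lam, feasible_dual lam.
  have [|e e_gt0 He] := @pos_perturb R _ (enum 'I_N) (fun i => dot lam0 (v i)) (fun=> -1).
    by move=> i _; exact: lam0v.
  (* All values of [lam0] exceed [e], so rescaling lifts them above 1. *)
  exists (e^-1 *: lam0); split=> [k|i]; first by rewrite mxE mulr_gt0 ?invr_gt0.
  have := He e; rewrite e_gt0 lexx => /(_ isT i); rewrite mem_enum => /(_ isT) h.
  rewrite dotZl mulrC ler_pdivlMr// mul1r; lra.
have [lam [lam_gt0 lam_ge1] full] : exists2 lam, feasible_dual lam & row_full (tight_mx lam).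
  move: {2}(p - \rank (tight_mx lam1))%N (leqnn (p - \rank (tight_mx lam1))) => r.
  elim: r lam1 lam1_feas => [|r IH] lam1 feas.
    rewrite leqn0 subn_eq0 => rk; exists lam1 => //.
    by rewrite /row_full eqn_leq rank_leq_col.
  have [rk|rk] := ltnP (\rank (tight_mx lam1)) p; last first.
    by move=> _; exists lam1 => //; rewrite /row_full eqn_leq rank_leq_col.
  have [lam2 feas2 rk2] := dual_step feas rk; move=> le_r.
  apply: (IH lam2) => //; rewrite -ltnS; apply: leq_trans le_r.
  by rewrite ltn_sub2l.
pose f := fullrankfun full.
have free := fullrowsub_free full; rewrite -/f in free.
(* A slack row is zero and cannot belong to a free family. *)
have tf i : tight lam (f i).
  apply/negPn/negP => /negPf nt.
  have : row i (rowsub f (tight_mx lam)) = 0.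
    by apply/rowP => j; rewrite !mxE nt.
  rewrite rowE; move/row_free_inj: free => inj; rewrite -(mul0mx _ (rowsub f (tight_mx lam))).
  move=> /inj /rowP /(_ i); rewrite !mxE !eqxx => /eqP; rewrite oner_eq0//.
exists lam, f; split=> // [i|]; first exact/eqP/tf.
suff -> : \matrix_(i, j) v (f i) j 0 = rowsub f (tight_mx lam) by [].
by apply/matrixP => i j; rewrite !mxE tf.
Qed.

End DualVertex.

(** * From vertices of the weight polyhedron to facets *)

Section Facets.
Variables (R : realType) (p : nat).
Implicit Types (lam y : 'cV[R]_p) (S F : set 'cV[R]_p).

(** Affine independence makes the square matrix of homogeneous coordinates invertible, yet the
    nonzero vector (lam, -c) lies in its kernel. *)
Lemma hyperplane_affinely_dependent lam c (y : 'I_p.+1 -> 'cV[R]_p) :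
  lam != 0 -> (forall i, dot lam (y i) = c) -> ~ affinely_independent y.
Proof.
move=> lam_neq0 yc indep.
pose M := row_mx (\matrix_(i, j) y i j 0) (const_mx 1) : 'M[R]_(p.+1, p + 1).
have M_ker : M *m col_mx lam (- c)%:M = 0.
  rewrite mul_row_col; apply/colP => i; rewrite !mxE big_ord1 !mxE mul1r mulr1n.
  apply/eqP; rewrite subr_eq0 -(yc i); apply/eqP/eq_bigr => j _.
  by rewrite mxE mulrC.
have M_free : row_free M.
  rewrite -kermx_eq0; apply/negPn/negP => /rowV0Pn[w /sub_kermxP wM] /negP; apply.
  move: wM; rewrite mul_mx_row -row_mx0 => /eq_row_mx[wy w1].
  apply/eqP/rowP => i; rewrite mxE; apply: (indep (w 0)).
    have w1_0 : (w *m (const_mx 1 : 'cV[R]_p.+1)) 0 0 = 0 by rewrite w1 mxE.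
    rewrite mxE in w1_0; rewrite -[RHS]w1_0.
    by apply: eq_bigr => j _; rewrite mxE mulr1.
  apply/colP => k; have wy_k : (w *m \matrix_(i, j) y i j 0) 0 k = 0 by rewrite wy mxE.
  rewrite mxE in wy_k; rewrite [RHS]mxE -[RHS]wy_k summxE.
  by apply: eq_bigr => j _; rewrite !mxE.
have MT_free : row_free M^T.
  by rewrite /row_free mxrank_tr (eqP M_free) addn1.
have : (col_mx lam (- c)%:M)^T *m M^T = 0 *m M^T by rewrite -trmx_mul M_ker trmx0 mul0mx.
move=> /(row_free_inj MT_free) /(congr1 trmx); rewrite trmxK trmx0 -col_mx0.
move=> /eq_col_mx[lam0 _]; move/eqP: lam_neq0; apply; rewrite lam0.
by apply/colP => k; rewrite !mxE.
Qed.

Lemma translate_affinely_independent d (y0 : 'cV[R]_p) (v : 'I_d -> 'cV[R]_p) :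
  row_free (\matrix_(i, j) v i j 0) -> affinely_independent (fun i => v i + y0).
Proof.
move=> /row_free_inj inj a a0; under eq_bigr do rewrite scalerDr.
rewrite big_split/= -scaler_suml a0 scale0r addr0 => av i.
have : (\row_i a i) *m (\matrix_(i, j) v i j 0) = 0 *m (\matrix_(i, j) v i j 0).
  rewrite mul0mx; apply/rowP => k.
  have av_k : (\sum_i a i *: v i) k 0 = 0 by rewrite av mxE.
  by rewrite [RHS]mxE -[RHS]av_k mxE summxE; apply: eq_bigr => j _; rewrite !mxE.
by move=> /inj/rowP/(_ i); rewrite !mxE.
Qed.

(** Bridges [p] and [p.-1.+1] when the dimension of a facet is computed. *)
Lemma affinely_independent_cast d d' (e : d' = d) (y : 'I_d -> 'cV[R]_p) :
  affinely_independent y -> affinely_independent (fun i => y (cast_ord e i)).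
Proof.
case: _ / e y => y; suff -> : (fun i => y (cast_ord erefl i)) = y by [].
by apply: funext => i; rewrite cast_ord_id.
Qed.

(* The last clause expresses that F contains p affinely independent points. *)
Lemma visible_positive_facet (Ss : seq 'cV[R]_p) y0 lam0 : (0 < p)%N ->
  let S := [set` Ss] in
  positive lam0 -> (forall s, S s -> dot lam0 y0 < dot lam0 s) ->
  (forall lam k, (forall j, 0 <= lam j 0) -> lam k 0 = 0 ->
     exists2 s, S s & dot lam s < dot lam y0 + 1) ->
  exists lam F, [/\ positive lam, facet (convex_hull S) F,
    nondominated_face (convex_hull S) F,
    forall y, F y -> dot lam y = dot lam y0 + 1 &
    forall lam' c, (forall y, F y -> dot lam' y = c) ->
      lam' = (c - dot lam' y0) *: lam].
Proof.
move=> p_gt0 S lam0_gt0 lam0S bnd.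
pose v (i : 'I_(size Ss)) := tnth (in_tuple Ss) i - y0.
have Sv i : S (v i + y0) by rewrite subrK; exact: mem_tnth.
have SvP s : S s -> exists i, s = v i + y0.
  by move=> /(tnthP (in_tuple Ss))[i ->]; exists i; rewrite subrK.
have v_bnd lam k : (forall j, 0 <= lam j 0) -> lam k 0 = 0 ->
    exists i, dot lam (v i) < 1.
  move=> lam_ge0 /(bnd _ _ lam_ge0)[s /SvP[i ->]].
  by rewrite dotDr addrC ltrD2l; exists i.
have lam0v i : 0 < dot lam0 (v i) by have := lam0S _ (Sv i); rewrite dotDr ltrDr.
have [lam [f [lam_gt0 lam_ge1 lam_f free]]] := dual_vertex v_bnd lam0_gt0 lam0v.
pose c := dot lam y0 + 1.
pose F := [set y | convex_hull S y /\ dot lam y = c].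
have Ff i : F (v (f i) + y0).
  by split; [exact: sub_hull|rewrite dotDr lam_f addrC].
have S_ge y : convex_hull S y -> c <= dot lam y.
  by move: y; apply: hull_dot_ge => y /SvP[i ->]; rewrite /c dotDr addrC lerD2r.
have F_face : face (convex_hull S) F by exists lam, c.
have lam_neq0 : lam != 0.
  by apply/eqP => lam0E; have := lam_gt0 (Ordinal p_gt0); rewrite lam0E mxE ltxx.
exists lam, F; split=> //.
- split=> //; split.
    exists (fun i => v (f (cast_ord (prednK p_gt0) i)) + y0); split=> [i|]; first exact: Ff.
    apply: (@affinely_independent_cast _ _ _ (fun i => v (f i) + y0)).
    exact: translate_affinely_independent.
  have e : p.+1 = p.-1.+2 by rewrite prednK.
  move=> y yF /(@affinely_independent_cast _ _ e _).
  by apply: (@hyperplane_affinely_dependent lam c) => // i; have [_ ->] := yF (cast_ord e i).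
- split=> // y [_ lamy] [y' Sy' /(dot_lt lam_gt0)].
  by rewrite lamy ltNge S_ge.
- by move=> y [].
(* [t] is the value of [lam'] on each [v (f i)], where [lam] has value 1; so [lam' - t *: lam]
   vanishes on [p] independent vectors. *)
move=> lam' c' lam'F; pose t := c' - dot lam' y0.
apply/eqP; rewrite -subr_eq0; apply/eqP; rewrite -/t.
have free_u : \matrix_(i, j) v (f i) j 0 \in unitmx by rewrite -row_free_unit.
suff : (\matrix_(i, j) v (f i) j 0) *m (lam' - t *: lam) = 0.
  by move=> /(congr1 (mulmx (invmx (\matrix_(i, j) v (f i) j 0)))); rewrite mulKmx// mulmx0.
apply/colP => i; rewrite [RHS]mxE -[RHS](_ : dot (v (f i)) (lam' - t *: lam) = 0).
  by rewrite mxE; apply: eq_bigr => j _; rewrite mxE.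
rewrite dotC dotBl dotZl lam_f mulr1 /t -(lam'F _ (Ff i)) dotDr; ring.
Qed.

End Facets.

(** * Invariants of the algorithm and its state at termination *)

Section Algorithm.
Variables (R : realType) (m n p : nat) (I : moilp m n p) (Ys : seq 'cV[R]_p).
Hypothesis YsE : enumerates I Ys.
Implicit Types (y : 'cV[R]_p) (s : bd_state R p).

Lemma bd_step_supported s y s' : bd_step I s y s' -> supported_nondominated I y.
Proof.
have opt (lam : 'cV[R]_p) x : positive lam -> weighted_sum_optimal I lam x ->
    supported_nondominated I (z R I x).
  move=> pos [Fx xopt]; apply/supportedP; split; first by exists x.
  by exists lam; split=> // y' [x' Fx' <-]; exact: xopt.
by case=> S E F lam x y' _ _ _ pos /(opt _ _ pos).
Qed.

Lemma reachable_supported s : bd_reachable I s ->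
  forall y, points s y -> supported_nondominated I y.
Proof.
elim=> [y|{}s y s' _ IH st]; first exact: bd_init_supported.
have ysup := bd_step_supported st.
by case: st IH ysup => S E F lam x y' _ _ _ _ _ _ _ /= IH ysup y2 => [/IH|[/IH|->]].
Qed.

Lemma bd_init_points s : bd_reachable I s -> bd_init I `<=` points s.
Proof.
elim=> // {}s y s' _ IH st.
by case: st IH => S E F lam x y' _ _ _ _ _ _ _ //= IH u /IH; left.
Qed.

(** When [F] is marked, its weight attains on [F] the minimum over all outcomes. This mentions only
    [F] and the outcomes, so it persists when [S] grows. *)
Lemma explored_weight s F : bd_reachable I s -> explored s F ->
  exists lam c, [/\ positive lam, forall y, F y -> dot lam y = c &
    forall y, outcomes I y -> c <= dot lam y].
Proof.
move=> reach; elim: reach F => [//|{}s y s' _ IH st].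
case: st IH => {s y s'} S E F lam x y' Ffacet _ [_ normal] pos [_ opt] Fy' eq_opt /= IH G.
  case=> [/IH//|->]; exists lam, (dot lam y'); split=> // [y Fy|_ [x' Fx' <-]].
    have FS : F `<=` convex_hull S by case: Ffacet.1 => l [c [_ ->]] u [].
    by apply/eqP; rewrite eq_le !normal//; exact: FS.
  by rewrite eq_opt opt.
exact: IH.
Qed.

Lemma terminated_extreme s y : (0 < p)%N ->
  (forall y' : 'cV[R]_p, outcomes I y' -> positive y') ->
  bd_reachable I s -> bd_terminated s -> nondominated_extreme I y -> points s y.
Proof.
move=> p_gt0 Ypos reach term yext; apply: contrapT => sy.
have Yy : outcomes I y := yext.1.1.1.
have [lam0 [lam0_gt0 strict]] := extreme_strict_support yext.
have sY y' : points s y' -> outcomes I y' by move=> /(reachable_supported reach)[[]].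
pose Ss := [seq y' <- Ys | `[< points s y' >]].
have SsE : points s = [set` Ss].
  rewrite eqEsubset; split=> y' /=; rewrite mem_filter; last by case/andP=> /asboolP.
  by move=> sy'; apply/andP; split; [exact/asboolP|exact/YsE/sY].
have [||lam [F [lam_gt0 Ffacet Fnd Flam Funiq]]] :=
    @visible_positive_facet _ _ Ss y lam0 p_gt0 lam0_gt0; rewrite -?SsE.
- by move=> y' sy'; apply: strict (sY _ sy') _ => yy'; rewrite yy' in sy'.
- move=> lam k lam_ge0 lamk.
  (* The tolerance 1 matches the normalisation lam.(s - y) >= 1. *)
  have [y' y'init lt] := bd_init_boundary YsE Ypos lam_ge0 lamk Yy ltr01.
  by exists y' => //; exact: bd_init_points y'init.
rewrite -SsE in Ffacet Fnd.
have [lam' [c [lam'_gt0 Fc Yc]]] := explored_weight reach (term F Ffacet Fnd).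
pose k := Ordinal p_gt0.
(* The weight used to explore [F] is a multiple of [lam]; positivity of both forces
   [dot lam' y < c], against the optimality of [c]. *)
have := lam'_gt0 k; rewrite (Funiq _ _ Fc) mxE pmulr_lgt0 ?lam_gt0//.
by rewrite subr_gt0 ltNge Yc.
Qed.

End Algorithm.

Theorem proposition11 (R : realType) (m n p : nat) (I : moilp m n p)
  (p_ge2 : (2 <= p)%N)
  (standing : standing_assumptions R I)
  (full_dim : has_dim (convex_hull (bd_init (R := R) I)) p) :
  (forall y : 'cV[R]_p, bd_generated I y -> supported_nondominated I y) /\
  (forall s : bd_state R p, bd_reachable I s -> bd_terminated s ->
     forall y : 'cV[R]_p, nondominated_extreme I y -> points s y).
Proof.
have [_ [yI ideal yI_gt0] poly] := standing.
have Ypos (y : 'cV[R]_p) : outcomes I y -> positive y.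
  by move=> [x Fx <-] k; exact: lt_le_trans (yI_gt0 k) ((ideal k).2 x Fx).
have [Ys YsE] := outcomes_enumerable Ypos poly.
split=> [y [s reach [|[s']]]|s reach term y].
- exact: reachable_supported YsE _ reach y.
- exact: bd_step_supported.
- by apply: terminated_extreme term => //; exact: ltnW.
Qed.
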